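(* Let $\mathcal{E}$ be a countable directed graph without sinks, let $S_{\mathcal{E}}$ be its graph inverse semigroup (defined by generators and relations) and let $T$ be the semigroup of path pairs of $\mathcal{E}$. The map $\Phi:S_{\mathcal{E}}\to T$, where $$\Phi(v)=(v,v),\quad \Phi(e)=(e,r(e)),\quad \Phi(e^{*})=(r(e),e),\quad \Phi(z)=z\qquad(v\in V,\ e\in E),$$ is a semigroup isomorphism.
   Context: $\mathcal{E}$ is a directed graph with countable vertex set $V$ and countable edge set $E$; $s(e),r(e)$ are the initial and terminal vertices of an edge $e$. No sinks: every vertex is the source of at least one edge. $E^*=\{e^*:e\in E\}$ is the set of reversed edges, with $s(e^* )=r(e)$, $r(e^* )=s(e)$. A finite path is $\alpha=e_1\cdots e_k$ with $r(e_i)=s(e_{i+1})$, $s(\alpha)=s(e_1)$, $r(\alpha)=r(e_k)$; each vertex $v$ is regarded as a finite path of length $0$ with $s(v)=r(v)=v$, and $s(\mu)\mu=\mu=\mu r(\mu)$ for every finite path $\mu$. The graph inverse semigroup $S_{\mathcal{E}}$ is the semigroup generated by $V\cup E\cup E^*\cup\{z\}$ ($z$ an element not in $V\cup E\cup E^*$) subject to the relations: (i) $z$ is a zero for $S_{\mathcal{E}}$; (ii) $s(e)e=e=er(e)$ and $r(e)e^*=e^*=e^*s(e)$ for all $e\in E$; (iii) $ab=z$ if $a,b\in V\cup E\cup E^*$ and $r(a)\ne s(b)$; (iv) $e^*f=z$ if $e,f\in E$ and $f\neq e$. (The semigroup generated by a set subject to relations is the quotient of the semigroup of words in that set, with juxtaposition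 as product, by the smallest congruence containing the relations.) $T$ is the set of pairs $(\alpha,\beta)$ of finite paths with $r(\alpha)=r(\beta)$, together with a zero element $z$, with involution $z^*=z$, $(\alpha,\beta)^*=(\beta,\alpha)$ and product $(\alpha,\alpha'\mu)(\alpha',\beta)=(\alpha,\beta\mu)$, $(\alpha,\alpha')(\alpha'\mu,\beta')=(\alpha\mu,\beta')$, all other products being $z$.
   Formalization: The presentation of the graph inverse semigroup is completed by the relations vv = v for each vertex v and e*e = r(e) for each edge e; with only relations (i)–(iv), e*e and r(e) are distinct but have the same image, so the map is not injective. *)

(* Defs.v *)
(* Classical logic ([boolp]) is used only to quotient by an undecidable
   congruence. *)
From HB Require Import structures.
From mathcomp Require Import all_boot boolp.

Set Implicit Arguments.
Unset Strict Implicit.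
Unset Printing Implicit Defensive.

Record digraph := Digraph {
  vertex : countType;
  edge : countType;
  src : edge -> vertex;
  tgt : edge -> vertex }.

Arguments src {d}.
Arguments tgt {d}.

Definition no_sinks (G : digraph) : Prop :=
  forall v : vertex G, exists e : edge G, src e = v.

Fixpoint walk (G : digraph) (v : vertex G) (l : seq (edge G)) : bool :=
  if l is e :: l' then (src e == v) && walk (tgt e) l' else true.

(* The path [e_1 ... e_k] is encoded by [(s(e_1), [:: e_1; ...; e_k])], and the
   path of length 0 at [v] by [(v, [::])]; the encoding is unique. *)
Record fpath (G : digraph) := FPath {
  fpath_val : vertex G * seq (edge G);
  fpathP : walk fpath_val.1 fpath_val.2 }.

HB.instance Definition _ (G : digraph) := [isSub for @fpath_val G].
HB.instance Definition _ (G : digraph) := [Choice of fpath G by <:].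

Section Paths.
Variable G : digraph.
Implicit Types (v : vertex G) (e : edge G) (l : seq (edge G)) (p q m : fpath G).

Definition psrc p : vertex G := (val p).1.
Definition pedges p : seq (edge G) := (val p).2.

Definition wend v l : vertex G := last v (map tgt l).
Definition ptgt p : vertex G := wend (psrc p) (pedges p).

Definition vpath v : fpath G := @FPath G (v, [::]) isT.

Fact epath_subproof e : walk (src e) [:: e].
Proof. by rewrite /= eqxx. Qed.
Definition epath e : fpath G := @FPath G (src e, [:: e]) (epath_subproof e).

(* Concatenation [p q]; only meaningful when [ptgt p = psrc q]. *)
Definition pcat p q : fpath G := insubd p (psrc p, pedges p ++ pedges q).

Definition pprefix q p : bool :=
  (psrc q == psrc p) && prefix (pedges q) (pedges p).

(* The path [m] such that [p = q m]; only meaningful when [pprefix q p]. *)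
Definition presidual q p : fpath G :=
  insubd p (ptgt q, drop (size (pedges q)) (pedges p)).

Lemma walk_cat v l1 l2 : walk v (l1 ++ l2) = walk v l1 && walk (wend v l1) l2.
Proof. by elim: l1 v => //= e l1 IH v; rewrite IH andbA. Qed.

Lemma wend_cat v l1 l2 : wend v (l1 ++ l2) = wend (wend v l1) l2.
Proof. by rewrite /wend map_cat last_cat. Qed.

Lemma fpath_eq p q : psrc p = psrc q -> pedges p = pedges q -> p = q.
Proof.
move=> e1 e2; apply: val_inj.
rewrite [LHS]surjective_pairing [RHS]surjective_pairing.
by congr pair; [exact: e1 | exact: e2].
Qed.

Lemma pcat_val p q : ptgt p = psrc q -> val (pcat p q) = (psrc p, pedges p ++ pedges q).
Proof.
move=> pq; rewrite /pcat insubdK // unfold_in /= walk_cat (fpathP p) /=.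
by rewrite -/(ptgt p) pq; apply: fpathP.
Qed.

Lemma psrc_pcat p q : ptgt p = psrc q -> psrc (pcat p q) = psrc p.
Proof. by move=> pq; rewrite /psrc pcat_val. Qed.

Lemma pedges_pcat p q :
  ptgt p = psrc q -> pedges (pcat p q) = pedges p ++ pedges q.
Proof. by move=> pq; rewrite /pedges pcat_val. Qed.

Lemma ptgt_pcat p q : ptgt p = psrc q -> ptgt (pcat p q) = ptgt q.
Proof.
by move=> pq; rewrite /ptgt psrc_pcat // pedges_pcat // wend_cat -/(ptgt p) pq.
Qed.

Lemma pcatA p q m : ptgt p = psrc q -> ptgt q = psrc m ->
  pcat (pcat p q) m = pcat p (pcat q m).
Proof.
move=> pq qm; have pqm : ptgt (pcat p q) = psrc m by rewrite ptgt_pcat.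
have pqm' : ptgt p = psrc (pcat q m) by rewrite psrc_pcat.
apply: fpath_eq; rewrite ?(psrc_pcat pqm) ?(psrc_pcat pqm') ?psrc_pcat //.
by rewrite (pedges_pcat pqm) (pedges_pcat pqm') !pedges_pcat // catA.
Qed.

Lemma pcat_vpathl p : pcat (vpath (psrc p)) p = p.
Proof. by apply: fpath_eq; rewrite ?psrc_pcat ?pedges_pcat. Qed.

Lemma pcat_vpathr p : pcat p (vpath (ptgt p)) = p.
Proof. by apply: fpath_eq; rewrite ?psrc_pcat ?pedges_pcat //= cats0. Qed.

Lemma pprefixP q p :
  pprefix q p -> ptgt q = psrc (presidual q p) /\ p = pcat q (presidual q p).
Proof.
case/andP=> /eqP sqp /prefixP [l lE].
have rE : val (presidual q p) = (ptgt q, l).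
  rewrite /presidual insubdK lE ?drop_size_cat // unfold_in /=.
  have := fpathP p.
  rewrite -[(fpath_val p).1]/(psrc p) -[(fpath_val p).2]/(pedges p).
  by rewrite -sqp lE walk_cat => /andP[].
have rs : ptgt q = psrc (presidual q p) by rewrite /psrc rE.
split=> //; apply: fpath_eq; rewrite ?psrc_pcat ?pedges_pcat //.
by rewrite lE /(pedges (presidual _ _)) rE.
Qed.

Lemma pprefix_pcat q m : ptgt q = psrc m -> pprefix q (pcat q m).
Proof.
by move=> qm; rewrite /pprefix psrc_pcat // pedges_pcat // eqxx prefix_prefix.
Qed.

Lemma pcatI q m m' : ptgt q = psrc m -> ptgt q = psrc m' ->
  pcat q m = pcat q m' -> m = m'.
Proof.
move=> qm qm' /(congr1 pedges); rewrite !pedges_pcat // => /eqP.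
rewrite eqseq_cat // eqxx => /eqP mm'.
by apply: fpath_eq; rewrite // -qm -qm'.
Qed.

Lemma presidual_pcat q m : ptgt q = psrc m -> presidual q (pcat q m) = m.
Proof.
move=> qm; have [r1 r2] := pprefixP (pprefix_pcat qm).
by apply/esym/(pcatI qm r1).
Qed.

Lemma pcat_comparable p q m m' : ptgt p = psrc m -> ptgt q = psrc m' ->
  pcat p m = pcat q m' -> pprefix p q || pprefix q p.
Proof.
move=> pm qm E; have := congr1 psrc E; have := congr1 pedges E.
rewrite !psrc_pcat // !pedges_pcat // /pprefix => + ->; rewrite eqxx /= => {}E.
have [le|/ltnW le] := leqP (size (pedges p)) (size (pedges q)).
  by rewrite prefixE -(takel_cat (pedges m') le) -E take_size_cat ?eqxx.
by rewrite orbC prefixE -(takel_cat (pedges m) le) E take_size_cat ?eqxx.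
Qed.

End Paths.

Definition cotail (G : digraph) : pred (fpath G * fpath G) :=
  fun pq => ptgt pq.1 == ptgt pq.2.

(* [None] is the zero [z]. *)
Definition path_pairs (G : digraph) : Type := option {pq | @cotail G pq}.

HB.instance Definition _ (G : digraph) := Choice.on (path_pairs G).

Section PathPairs.
Variable G : digraph.
Implicit Types (p q m a b c d : fpath G) (x y w : path_pairs G).

Definition tzero : path_pairs G := None.

(* The pair [(p, q)]; only meaningful when [ptgt p = ptgt q]. *)
Definition tpair p q : path_pairs G := insub (p, q).

Definition tmul x y : path_pairs G :=
  match x, y with
  | Some u, Some t =>
      let: (a, b) := val u in
      let: (c, d) := val t in
      if pprefix c b then tpair a (pcat d (presidual c b))
      else if pprefix b c then tpair (pcat a (presidual b c)) d
      else tzero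
  | _, _ => tzero
  end.

Lemma tpairP x : x = tzero \/ exists p q, ptgt p = ptgt q /\ x = tpair p q.
Proof.
case: x => [[[p q] pq]|]; [right | by left].
by exists p, q; split; [exact/eqP | rewrite /tpair insubT].
Qed.

Lemma tpair_inj p q p' q' : ptgt p = ptgt q ->
  tpair p q = tpair p' q' -> (p, q) = (p', q').
Proof.
move=> /eqP pq; rewrite /tpair insubT.
by case: insubP => // u _ <- [] /(congr1 val) /= <-.
Qed.

Lemma tpair_neq0 p q : ptgt p = ptgt q -> tpair p q <> tzero.
Proof. by move=> /eqP pq; rewrite /tpair insubT. Qed.

Lemma tmulE a b c d : ptgt a = ptgt b -> ptgt c = ptgt d ->
  tmul (tpair a b) (tpair c d) =
  if pprefix c b then tpair a (pcat d (presidual c b))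
  else if pprefix b c then tpair (pcat a (presidual b c)) d
  else tzero.
Proof. by move=> /eqP ab /eqP cd; rewrite {1 2}/tpair !insubT. Qed.

Lemma tmul_l a c d m : ptgt a = ptgt m -> ptgt c = psrc m -> ptgt c = ptgt d ->
  tmul (tpair a (pcat c m)) (tpair c d) = tpair a (pcat d m).
Proof.
by move=> am cm cd; rewrite tmulE ?ptgt_pcat // pprefix_pcat // presidual_pcat.
Qed.

Lemma tmul_r a b d m : ptgt a = ptgt b -> ptgt b = psrc m -> ptgt m = ptgt d ->
  tmul (tpair a b) (tpair (pcat b m) d) = tpair (pcat a m) d.
Proof.
move=> ab bm md; rewrite tmulE ?ptgt_pcat // pprefix_pcat // presidual_pcat //.
case: ifP => // /pprefixP [r1 r2].
have am : ptgt a = psrc m by rewrite ab.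
have sz : size (pedges b) =
    size (pedges b) + (size (pedges m) + size (pedges (presidual (pcat b m) b))).
  by rewrite {1}r2 !pedges_pcat // !size_cat addnA.
have /andP[/nilP m0 /nilP r0] :
    (size (pedges m) == 0) && (size (pedges (presidual (pcat b m) b)) == 0).
  by rewrite -addn_eq0 -(eqn_add2l (size (pedges b))) -sz addn0.
have mv : m = vpath (ptgt a) by apply: fpath_eq => //; rewrite am.
have -> : presidual (pcat b m) b = vpath (ptgt d).
  by apply: fpath_eq; rewrite // -r1 ptgt_pcat.
by rewrite mv !pcat_vpathr.
Qed.

Lemma tmul_0 a b c d : ptgt a = ptgt b -> ptgt c = ptgt d ->
  (forall m, ptgt c = psrc m -> b <> pcat c m) ->
  (forall m, ptgt b = psrc m -> c <> pcat b m) ->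
  tmul (tpair a b) (tpair c d) = tzero.
Proof.
move=> ab cd nb nc; rewrite tmulE //.
case: ifP => [/pprefixP[r1 r2]|_]; first by case: (nb _ r1 r2).
by case: ifP => [/pprefixP[r1 r2]|//]; case: (nc _ r1 r2).
Qed.

Lemma tmul0x x : tmul tzero x = tzero. Proof. by []. Qed.
Lemma tmulx0 x : tmul x tzero = tzero. Proof. by case: x. Qed.

(* Associativity: [(a, b)] is determined by the partial bijection
   [b m |-> a m] of the set of paths, and [tmul] is composition. *)
Definition tgraph x p q : Prop :=
  exists a b m, [/\ ptgt a = ptgt b, x = tpair a b,
                    ptgt a = psrc m, p = pcat a m & q = pcat b m].

Lemma tgraph_pair a b p q : ptgt a = ptgt b ->
  tgraph (tpair a b) p q <->
  exists m, [/\ ptgt a = psrc m, p = pcat a m & q = pcat b m].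
Proof.
move=> ab; split=> [[a' [b' [m [_ /(tpair_inj ab) [<- <-] ? ? ?]]]]|[m [? ? ?]]].
  by exists m.
by exists a, b, m.
Qed.

Lemma tgraph_mul x y p q :
  tgraph (tmul x y) p q <-> exists m, tgraph x p m /\ tgraph y m q.
Proof.
have g0 p' q' : ~ tgraph tzero p' q'.
  by move=> [a [b [m [ab E _ _ _]]]]; apply: (tpair_neq0 ab).
case: (tpairP x) => [->|[a [b [ab ->]]]].
  by rewrite tmul0x; split=> [/g0|[m [/g0 ? _]]].
case: (tpairP y) => [->|[c [d [cd ->]]]].
  by rewrite tmulx0; split=> [/g0|[m [_ /g0]]].
rewrite tmulE //; case: ifP => [/pprefixP[]|ncb]; last case: ifP => [/pprefixP[]|nbc].
- move: (presidual c b) => n cn bE.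
  have dn : ptgt d = psrc n by rewrite -cd.
  have an : ptgt a = ptgt n by rewrite ab bE ptgt_pcat.
  have adn : ptgt a = ptgt (pcat d n) by rewrite ptgt_pcat.
  split=> [/(tgraph_pair _ _ adn) [m [am -> ->]]|].
    have nm : ptgt n = psrc m by rewrite -an.
    exists (pcat b m); split; first by apply/tgraph_pair => //; exists m.
    apply/tgraph_pair => //; exists (pcat n m).
    by rewrite bE !pcatA ?psrc_pcat.
  move=> [w [/(tgraph_pair _ _ ab) [m [am -> ->]] /(tgraph_pair _ _ cd) [k [ck E ->]]]].
  have nm : ptgt n = psrc m by rewrite -an.
  apply/(tgraph_pair _ _ adn); exists m; split=> //.
  rewrite pcatA //; congr pcat; apply/esym/(@pcatI _ c); rewrite ?psrc_pcat //.
  by rewrite -pcatA // -bE.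
- move: (presidual b c) => n bn cE.
  have an : ptgt a = psrc n by rewrite ab.
  have dn : ptgt n = ptgt d by rewrite -cd cE ptgt_pcat.
  have adn : ptgt (pcat a n) = ptgt d by rewrite ptgt_pcat.
  split=> [/(tgraph_pair _ _ adn) [m [am -> ->]]|].
    have nm : ptgt n = psrc m by rewrite -am ptgt_pcat.
    exists (pcat c m); split.
      by apply/tgraph_pair => //; exists (pcat n m); rewrite cE !pcatA ?psrc_pcat.
    by apply/tgraph_pair => //; exists m; rewrite cd -dn.
  move=> [w [/(tgraph_pair _ _ ab) [m [am -> ->]] /(tgraph_pair _ _ cd) [k [ck E ->]]]].
  have nk : ptgt n = psrc k by rewrite -ck cE ptgt_pcat.
  apply/(tgraph_pair _ _ adn); exists k; split=> //; first by rewrite ptgt_pcat.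
  rewrite pcatA //; congr pcat; apply/(@pcatI _ b); rewrite ?psrc_pcat //.
    by rewrite -ab.
  by rewrite -pcatA // -cE.
split=> [/g0 //|[w [/(tgraph_pair _ _ ab) [m [am _ ->]] /(tgraph_pair _ _ cd) [k [ck E _]]]]].
have bm : ptgt b = psrc m by rewrite -ab.
by have := pcat_comparable bm ck E; rewrite ncb nbc.
Qed.

Lemma tgraph_inj x y : (forall p q, tgraph x p q <-> tgraph y p q) -> x = y.
Proof.
have g0 p' q' : ~ tgraph tzero p' q'.
  by move=> [a [b [m [ab E _ _ _]]]]; apply: (tpair_neq0 ab).
have gd a b : ptgt a = ptgt b -> tgraph (tpair a b) a b.
  move=> ab; apply/tgraph_pair => //; exists (vpath (ptgt a)).
  by rewrite pcat_vpathr ab pcat_vpathr.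
case: (tpairP x) => [->|[a [b [ab ->]]]];
  case: (tpairP y) => [->//|[c [d [cd ->]]]] E.
- by have /E/g0 := gd _ _ cd.
- by have /E/g0 := gd _ _ ab.
have /E/(tgraph_pair _ _ cd) [m [cm aE bE]] := gd _ _ ab.
have /E/(tgraph_pair _ _ ab) [n [an cE dE]] := gd _ _ cd.
have dm : ptgt d = psrc m by rewrite -cd.
have m0 : pedges m = [::].
  have : size (pedges n) + size (pedges m) == 0.
    rewrite -(eqn_add2l (size (pedges a))) addnA -size_cat -pedges_pcat // -cE.
    by rewrite -size_cat -pedges_pcat // -aE addn0.
  by rewrite addn_eq0 => /andP[_ /nilP].
have mE : m = vpath (psrc m) by apply: fpath_eq.
by rewrite aE bE mE -{1}cm -dm !pcat_vpathr.
Qed.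

Lemma tmulA : associative tmul.
Proof.
move=> x y w; apply: tgraph_inj => p q; split.
  case/tgraph_mul=> m [xm /tgraph_mul [n [ym wn]]].
  by apply/tgraph_mul; exists n; split=> //; apply/tgraph_mul; exists m.
case/tgraph_mul=> n [/tgraph_mul [m [xm ym]] wn].
by apply/tgraph_mul; exists m; split=> //; apply/tgraph_mul; exists n.
Qed.

HB.instance Definition _ := isSemigroup.Build (path_pairs G) tmulA.

End PathPairs.

Arguments tzero {G}.

Inductive letter (G : digraph) :=
  | Vtx of vertex G
  | Edg of edge G
  | Star of edge G.

Section Letters.
Variable G : digraph.

Definition letter_code (a : letter G) : vertex G + (edge G + edge G) :=
  match a with Vtx v => inl v | Edg e => inr (inl e) | Star e => inr (inr e) end.

Definition letter_decode (c : vertex G + (edge G + edge G)) : letter G :=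
  match c with inl v => Vtx v | inr (inl e) => Edg e | inr (inr e) => Star e end.

Fact letter_codeK : cancel letter_code letter_decode. Proof. by case. Qed.

HB.instance Definition _ := Countable.copy (letter G) (can_type letter_codeK).

Definition lsrc (a : letter G) : vertex G :=
  match a with Vtx v => v | Edg e => src e | Star e => tgt e end.

Definition ltgt (a : letter G) : vertex G :=
  match a with Vtx v => v | Edg e => tgt e | Star e => src e end.

End Letters.

(* The free semigroup on [A]. *)
Definition word (A : choiceType) : Type := {w : seq A | w != [::]}.

Section Words.
Variable A : choiceType.

HB.instance Definition _ := Choice.on (word A).

Fact wmul_subproof (u w : word A) : val u ++ val w != [::].
Proof. by case: u => [[|a u] //= _]. Qed.

Definition wmul (u w : word A) : word A :=
  exist _ (val u ++ val w) (wmul_subproof u w).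

Fact wmulA : associative wmul.
Proof. by move=> u v w; apply: val_inj; apply: catA. Qed.

HB.instance Definition _ := isSemigroup.Build (word A) wmulA.

Definition wgen (a : A) : word A := exist _ [:: a] isT.

End Words.

Local Open Scope group_scope.

(* The generators are [V], [E], [E^*] and [z]; [None] is [z]. *)
Definition gis_word (G : digraph) : semigroupType := word (option (letter G)).

Section GraphInverseSemigroup.
Variable G : digraph.

Definition wz : gis_word G := wgen None.
Definition wl (a : letter G) : gis_word G := wgen (Some a).
Definition wv (v : vertex G) : gis_word G := wl (Vtx v).
Definition we (e : edge G) : gis_word G := wl (Edg e).
Definition ws (e : edge G) : gis_word G := wl (Star e).

(* [rel_vv] is the identity [s(mu) mu = mu = mu r(mu)] for the path [mu = v] of
   length 0, and [rel_see] is the case [f = e] of the product [e^* f].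
   Presentations that list only the other relations leave these two implicit,
   but they do not follow from them: [v v = v] fails at a vertex receiving no
   edge without [rel_vv], and [e^* e = r(e)] fails at every edge without
   [rel_see], whereas both identities hold in [path_pairs G]. *)
Inductive gis_rel : gis_word G -> gis_word G -> Prop :=
  | rel_zl (w : gis_word G) : gis_rel (wz * w) wz
  | rel_zr (w : gis_word G) : gis_rel (w * wz) wz
  | rel_vv (v : vertex G) : gis_rel (wv v * wv v) (wv v)
  | rel_el (e : edge G) : gis_rel (wv (src e) * we e) (we e)
  | rel_er (e : edge G) : gis_rel (we e * wv (tgt e)) (we e)
  | rel_sl (e : edge G) : gis_rel (wv (tgt e) * ws e) (ws e)
  | rel_sr (e : edge G) : gis_rel (ws e * wv (src e)) (ws e)
  | rel_ab (a b : letter G) : ltgt a <> lsrc b -> gis_rel (wl a * wl b) wz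
  | rel_sef (e f : edge G) : f <> e -> gis_rel (ws e * we f) wz
  | rel_see (e : edge G) : gis_rel (ws e * we e) (wv (tgt e)).

(* The smallest congruence containing [gis_rel]. *)
Inductive gis_cong : gis_word G -> gis_word G -> Prop :=
  | cong_rel u w : gis_rel u w -> gis_cong u w
  | cong_refl u : gis_cong u u
  | cong_sym u w : gis_cong u w -> gis_cong w u
  | cong_trans u v w : gis_cong u v -> gis_cong v w -> gis_cong u w
  | cong_mul u u' w w' :
      gis_cong u u' -> gis_cong w w' -> gis_cong (u * w) (u' * w').

Definition gis_congb : rel (gis_word G) := fun u w => `[< gis_cong u w >].

Fact gis_congb_refl : reflexive gis_congb.
Proof. by move=> u; apply/asboolP/cong_refl. Qed.

Fact gis_congb_sym : symmetric gis_congb.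
Proof. by move=> u w; apply/asboolP/asboolP; apply: cong_sym. Qed.

Fact gis_congb_trans : transitive gis_congb.
Proof.
by move=> v u w /asboolP uv /asboolP vw; apply/asboolP/(cong_trans uv vw).
Qed.

Canonical gis_congb_equiv :=
  EquivRel gis_congb gis_congb_refl gis_congb_sym gis_congb_trans.

Local Open Scope quotient_scope.

Definition gis : Type := {eq_quot gis_congb_equiv}.

HB.instance Definition _ := Choice.on gis.
HB.instance Definition _ := EqQuotient.on gis.

Definition gis_class (w : gis_word G) : gis := \pi_gis w.

Lemma gis_classP (u w : gis_word G) :
  gis_class u = gis_class w <-> gis_cong u w.
Proof.
have E := @eqmodP _ gis_congb_equiv u w.
by split=> [/E/asboolP|uw]; last exact/E/asboolP.
Qed.

Definition gis_mul (x y : gis) : gis := gis_class (repr x * repr y).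

Lemma gis_mulE (u w : gis_word G) :
  gis_mul (gis_class u) (gis_class w) = gis_class (u * w).
Proof. by apply/gis_classP/cong_mul; apply/gis_classP; apply: reprK. Qed.

Fact gis_mulA : associative gis_mul.
Proof.
move=> x y w; rewrite -[x]reprK -[y]reprK -[w]reprK.
by rewrite -!/(gis_class _) !gis_mulE mulgA.
Qed.

HB.instance Definition _ := isSemigroup.Build gis gis_mulA.

Definition sv (v : vertex G) : gis := gis_class (wv v).
Definition se (e : edge G) : gis := gis_class (we e).
Definition ss (e : edge G) : gis := gis_class (ws e).
Definition sz : gis := gis_class wz.

End GraphInverseSemigroup.

Arguments sz {G}.

(* Main.v *)
(* Every element of the graph inverse semigroup is [z] or a normal form
   [s(p) e_1 ... e_k f_l^* ... f_1^*], where [p = e_1 ... e_k] and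
   [q = f_1 ... f_l] have the same end: normal forms are stable under right
   multiplication by a generator. The map sending a pair [(p, q)] to its normal
   form turns this right multiplication into the one of [path_pairs], so it is
   a left inverse of [Phi]; it is a right inverse since [Phi] maps the
   normal form of [(p, q)] to [(p, q)]. *)
Require Import Defs.
From HB Require Import structures.
From mathcomp Require Import all_boot.
(* [all_boot] shadows [fpath]. *)
Import Defs.

Set Implicit Arguments.
Unset Strict Implicit.
Unset Printing Implicit Defensive.

Local Open Scope group_scope.

(** * Extension of a map on generators to a homomorphism on words *)

Section WordExtension.
Variables (A : choiceType) (T : semigroupType) (x0 : T) (f : A -> T).

(* The default [x0] is never reached, words being nonempty. *)
Definition wext (w : word A) : T :=
  if val w is a :: s then foldl (fun x b => x * f b) (f a) s else x0.

Lemma wext_gen a : wext (wgen a) = f a.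
Proof. by []. Qed.

Lemma wextM (u w : word A) : wext (u * w) = wext u * wext w.
Proof.
case: u w => [[|a s] //= ?] [[|b t] //= ?].
rewrite /wext /= foldl_cat /=.
by elim/last_ind: t => //= t c IH; rewrite !foldl_rcons IH mulgA.
Qed.

Lemma word_ind (P : word A -> Prop) :
  (forall a, P (wgen a)) -> (forall w a, P w -> P (w * wgen a)) ->
  forall w, P w.
Proof.
move=> P1 PM [s]; elim/last_ind: s => [//|s a IH] sa.
case: (boolP (s != [::])) => [s0 | /negPn/eqP s0].
  suff -> : exist _ (rcons s a) sa = (exist _ s s0 : word A) * wgen a.
    exact/PM/IH.
  by apply: val_inj; rewrite /= cats1.
suff -> : exist _ (rcons s a) sa = wgen a :> word A by [].
by apply: val_inj; rewrite /= s0.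
Qed.

End WordExtension.

Section Proposition2.
Variable G : digraph.
Implicit Types (v : vertex G) (e f : edge G) (p q : fpath G).
Implicit Types (a : letter G) (t : path_pairs G).

(** Suited to the second component of a pair: right multiplication by [e^*] prepends [e] to it. *)
Lemma fpath_indl (P : fpath G -> Prop) :
  (forall v, P (vpath v)) ->
  (forall e q, tgt e = psrc q -> P q -> P (pcat (epath e) q)) ->
  forall q, P q.
Proof.
move=> P0 PS [[v l]]; elim: l v => [|e l IH] v w.
  by rewrite (_ : FPath w = vpath v) //; apply: fpath_eq.
have /andP [/eqP ev wl] : (src e == v) && walk (tgt e) l by [].
pose q := @FPath G (tgt e, l) wl.
rewrite (_ : FPath w = pcat (epath e) q); first exact/PS/IH.
by apply: fpath_eq; rewrite ?psrc_pcat ?pedges_pcat.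
Qed.

(** Suited to the first component: right multiplication of [(p, r(p))] by [e] appends [e] to [p]. *)
Lemma fpath_indr (P : fpath G -> Prop) :
  (forall v, P (vpath v)) ->
  (forall p e, ptgt p = src e -> P p -> P (pcat p (epath e))) ->
  forall p, P p.
Proof.
move=> P0 PS [[v l]]; elim/last_ind: l => [|l e IH] w.
  by rewrite (_ : FPath w = vpath v) //; apply: fpath_eq.
have /andP [wl /eqP ev] : walk v l && (src e == wend v l).
  by have : walk v (rcons l e) by []; rewrite -cats1 walk_cat /= andbT.
pose p := @FPath G (v, l) wl.
have pe : ptgt p = src e by [].
rewrite (_ : FPath w = pcat p (epath e)); first exact/PS/IH.
by apply: fpath_eq; rewrite ?psrc_pcat ?pedges_pcat // cats1.
Qed.

(** * Right multiplication of path pairs by the images of the generators *)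

Definition gen_pair (x : option (letter G)) : path_pairs G :=
  match x with
  | None => tzero
  | Some (Vtx v) => tpair (vpath v) (vpath v)
  | Some (Edg e) => tpair (epath e) (vpath (tgt e))
  | Some (Star e) => tpair (vpath (tgt e)) (epath e)
  end.

Lemma mul0t t : tzero * t = tzero. Proof. exact: tmul0x. Qed.
Lemma mult0 t : t * tzero = tzero. Proof. exact: tmulx0. Qed.

(** A nonzero product requires one of [b], [c] to extend the other, hence a common source. *)
Lemma mul_tpair_neq (a b c d : fpath G) : ptgt a = ptgt b -> ptgt c = ptgt d ->
  psrc b <> psrc c -> tpair a b * tpair c d = tzero.
Proof.
move=> ab cd bc; apply: tmul_0 => // m km E; apply: bc.
  by rewrite E psrc_pcat.
by rewrite E psrc_pcat.
Qed.

Lemma tpair_mulV p q : ptgt p = ptgt q ->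
  tpair p q * tpair (vpath (psrc q)) (vpath (psrc q)) = tpair p q.
Proof.
(* The first product rule, with the vertex [s(q)] as common prefix and [q] itself as remainder. *)
move=> pq; have := @tmul_l _ p (vpath (psrc q)) (vpath (psrc q)) q pq.
by rewrite !pcat_vpathl; apply.
Qed.

Lemma tpair_mulE p e : ptgt p = src e ->
  tpair p (vpath (src e)) * tpair (epath e) (vpath (tgt e)) =
  tpair (pcat p (epath e)) (vpath (tgt e)).
Proof.
move=> pe; rewrite -{1}[epath e]pcat_vpathl; exact: tmul_r.
Qed.

Lemma tpair_mulS p e q : ptgt p = ptgt q -> tgt e = psrc q ->
  tpair p q * tpair (vpath (tgt e)) (epath e) = tpair p (pcat (epath e) q).
Proof.
move=> pq eq; rewrite -{1}[q]pcat_vpathl -eq; exact: tmul_l.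
Qed.

Lemma tpair_mulSE p q e : ptgt p = ptgt q -> tgt e = psrc q ->
  tpair p (pcat (epath e) q) * tpair (epath e) (vpath (tgt e)) = tpair p q.
Proof.
move=> pq eq; rewrite -[in RHS](pcat_vpathl q) -eq; exact: tmul_l.
Qed.

(** If [f q] and [e] were comparable as paths, their first edges would agree. *)
Lemma tpair_mulSE_neq p q e f : ptgt p = ptgt q -> tgt f = psrc q -> f <> e ->
  tpair p (pcat (epath f) q) * tpair (epath e) (vpath (tgt e)) = tzero.
Proof.
move=> pq fq fe; apply: tmul_0; rewrite ?ptgt_pcat // => m mE.
  by move/(congr1 (@pedges G)); rewrite !pedges_pcat // => -[].
move/(congr1 (@pedges G)); rewrite !pedges_pcat ?ptgt_pcat //.
by case=> /esym.
Qed.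

(** * Descent of the homomorphism from words to the quotient *)

Definition word_pair (w : gis_word G) : path_pairs G := wext tzero gen_pair w.

Lemma word_pair_rel (u w : gis_word G) :
  gis_rel u w -> word_pair u = word_pair w.
Proof.
case; rewrite /word_pair.
- by move=> w'; rewrite wextM mul0t.
- by move=> w'; rewrite wextM mult0.
- by move=> v; rewrite wextM; apply: (@tpair_mulV (vpath v) (vpath v)).
- move=> e; rewrite wextM.
  apply: (etrans (@tpair_mulE (vpath (src e)) e erefl)).
  by congr tpair; apply: (pcat_vpathl (epath e)).
- by move=> e; rewrite wextM; apply: (@tpair_mulV (epath e) (vpath (tgt e))).
- move=> e; rewrite wextM.
  apply: (etrans (@tpair_mulS (vpath (tgt e)) e (vpath (tgt e)) erefl erefl)).
  by congr tpair; apply: (pcat_vpathr (epath e)).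
- by move=> e; rewrite wextM; apply: (@tpair_mulV (vpath (tgt e)) (epath e)).
(* In all nine cases the second component of [gen_pair (Some a)] starts at [ltgt a], and the first
   component of [gen_pair (Some b)] at [lsrc b]. *)
- by move=> [v|e|e] [v'|f|f] ab; rewrite wextM; apply: mul_tpair_neq.
(* Writing [e] as [e r(e)] gives it the form of an edge followed by a path. *)
- move=> e f fe; rewrite wextM !wext_gen /= -[epath e]pcat_vpathr.
  by apply: tpair_mulSE_neq => //; exact: nesym.
- move=> e; rewrite wextM !wext_gen /= -{1}[epath e]pcat_vpathr.
  exact: tpair_mulSE.
Qed.

Lemma word_pair_cong (u w : gis_word G) :
  gis_cong u w -> word_pair u = word_pair w.
Proof.
elim=> [u' w'|//|u' w' _ ->//|u' v' w' _ -> _ ->//|u1 u2 w1 w2 _ E1 _ E2].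
  exact: word_pair_rel.
by rewrite /word_pair !wextM -!/(word_pair _) E1 E2.
Qed.

(** This is [Phi]; by [word_pair_cong] the choice of representative does not matter. *)
Definition gis_pair (x : gis G) : path_pairs G := word_pair (repr x).

Lemma gis_pair_class w : gis_pair (gis_class w) = word_pair w.
Proof. by apply: word_pair_cong; apply/gis_classP; apply: reprK. Qed.

Lemma gis_classM (u w : gis_word G) :
  gis_class (u * w) = gis_class u * gis_class w.
Proof. by rewrite -gis_mulE. Qed.

Lemma gis_pairM : {morph gis_pair : x y / x * y}.
Proof.
move=> x y; rewrite -[x]reprK -[y]reprK -!/(gis_class _) -gis_classM.
by rewrite !gis_pair_class; apply: wextM.
Qed.

HB.instance Definition _ :=
  isMultiplicative.Build (gis G) (path_pairs G) gis_pair gis_pairM.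

(** * Generators and normal forms in the graph inverse semigroup *)

Definition gis_gen (x : option (letter G)) : gis G := gis_class (wgen x).

Lemma gis_ind (P : gis G -> Prop) :
  (forall x, P (gis_gen x)) -> (forall y x, P y -> P (y * gis_gen x)) ->
  forall y, P y.
Proof.
move=> P1 PM y; rewrite -[y]reprK -/(gis_class _).
elim/word_ind: (repr y) => [x|w x Pw]; first exact: P1.
by rewrite gis_classM; apply: PM.
Qed.

Lemma gis_rel_eq (u w : gis_word G) : gis_rel u w -> gis_class u = gis_class w.
Proof. by move=> uw; apply/gis_classP/cong_rel. Qed.

Lemma gis_mul0 (x : gis G) : sz * x = sz.
Proof.
rewrite -[x]reprK -/(gis_class _) -gis_classM; exact/gis_rel_eq/rel_zl.
Qed.

Lemma gis_mulx0 (x : gis G) : x * sz = sz.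
Proof.
rewrite -[x]reprK -/(gis_class _) -gis_classM; exact/gis_rel_eq/rel_zr.
Qed.

(** A semigroup has no empty product, so the product starts with the vertex [s(p)], which also
    covers paths of length 0. *)
Definition path_gis p : gis G :=
  foldl (fun x e => x * se e) (sv (psrc p)) (pedges p).

(** Folding from the right puts the star of the first edge of [q] last, so that prepending an edge
    to [q] is a right multiplication. *)
Definition pair_nf p q : gis G :=
  foldr (fun e x => x * ss e) (path_gis p) (pedges q).

Lemma path_gis_pcat p e : ptgt p = src e ->
  path_gis (pcat p (epath e)) = path_gis p * se e.
Proof.
by move=> pe; rewrite /path_gis psrc_pcat // pedges_pcat // cats1 foldl_rcons.
Qed.

Lemma pair_nf_pcat p q e : tgt e = psrc q ->
  pair_nf p (pcat (epath e) q) = pair_nf p q * ss e.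
Proof. by move=> eq; rewrite /pair_nf pedges_pcat. Qed.

(** The last factor absorbs the vertex: [v v = v] for length 0, [e r(e) = e] otherwise. *)
Lemma path_gis_mulV p : path_gis p * sv (ptgt p) = path_gis p.
Proof.
elim/fpath_indr: p => [v|p e pe _].
  rewrite -gis_classM; exact/gis_rel_eq/rel_vv.
rewrite path_gis_pcat // ptgt_pcat // -mulgA; congr (_ * _).
rewrite -gis_classM; exact/gis_rel_eq/rel_er.
Qed.

Lemma pair_nf_mulV p q : ptgt p = ptgt q ->
  pair_nf p q * sv (psrc q) = pair_nf p q.
Proof.
elim/fpath_indl: q => [v pv|e q eq _ _]; first by have := path_gis_mulV p; rewrite pv.
rewrite pair_nf_pcat // psrc_pcat // -mulgA; congr (_ * _).
rewrite -gis_classM; exact/gis_rel_eq/rel_sr.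
Qed.

Definition pair_gis t : gis G :=
  if t is Some u then pair_nf (val u).1 (val u).2 else sz.

Lemma pair_gisE p q : ptgt p = ptgt q -> pair_gis (tpair p q) = pair_nf p q.
Proof. by move=> /eqP pq; rewrite /tpair insubT. Qed.

(** For [e] and [e^*] the normal form is [s(e) e] and [r(e) e^*], whose initial vertex is
    absorbed. *)
Lemma pair_gis_gen x : pair_gis (gen_pair x) = gis_gen x.
Proof.
case: x => [[v|e|e]|] //; rewrite pair_gisE // /pair_nf /path_gis /=.
  by rewrite -gis_classM; exact/gis_rel_eq/rel_el.
by rewrite -gis_classM; exact/gis_rel_eq/rel_sl.
Qed.

(** The generator meets the end of the normal form, at the vertex [s(q)]. If it does not start
    there, both sides are [z]. Otherwise a vertex is absorbed, a star lengthens [q], and an edge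
    either lengthens [p] (when [q] has length 0) or meets the star of the first edge of [q]. *)
Lemma pair_gis_mul_gen t x : pair_gis t * gis_gen x = pair_gis (t * gen_pair x).
Proof.
have [->|[p [q [pq ->]]]] := tpairP t; first by rewrite mul0t gis_mul0.
case: x => [a|]; last by rewrite mult0 gis_mulx0.
rewrite pair_gisE //; have [qa|/eqP qa] := eqVneq (psrc q) (lsrc a); last first.
  (* Inserting the vertex [s(q)] before the generator exposes a product that [rel_ab] sends to
     [z]. *)
  rewrite -pair_nf_mulV // -mulgA -gis_classM.
  rewrite (gis_rel_eq (@rel_ab _ (Vtx (psrc q)) a qa)) gis_mulx0.
  by case: a qa => [v|e|e] qa; rewrite mul_tpair_neq.
case: a qa => [v|e|e] /= qa.
- by rewrite -qa tpair_mulV // pair_gisE // -[in RHS]pair_nf_mulV.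
- elim/fpath_indl: q pq qa => [v|f q fq _] pq.
    move=> ve; have {}ve : v = src e by [].
    rewrite ve in pq *; rewrite tpair_mulE // pair_gisE ?ptgt_pcat //.
    by rewrite /pair_nf /= path_gis_pcat.
  move=> _; rewrite ptgt_pcat // in pq.
  rewrite pair_nf_pcat // -mulgA -gis_classM.
  (* The factor [f^* e] is either [r(f) = s(q)], which the normal form of [(p, q)] absorbs, or
     [z]. *)
  have [fe|/eqP fe] := eqVneq f e.
    rewrite -fe tpair_mulSE // pair_gisE // (gis_rel_eq (rel_see f)).
    by rewrite fq; apply: pair_nf_mulV.
  by rewrite tpair_mulSE_neq // (gis_rel_eq (rel_sef (nesym fe))) gis_mulx0.
- by rewrite tpair_mulS // pair_gisE ?ptgt_pcat // pair_nf_pcat.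
Qed.

(** * The two maps are mutually inverse *)

Lemma gis_pairK : cancel gis_pair pair_gis.
Proof.
elim/gis_ind=> [x|y x IH]; first by rewrite gis_pair_class pair_gis_gen.
by rewrite gis_pairM gis_pair_class -pair_gis_mul_gen IH.
Qed.

Lemma path_gisK p : gis_pair (path_gis p) = tpair p (vpath (ptgt p)).
Proof.
elim/fpath_indr: p => [v|p e pe IH]; first by rewrite gis_pair_class.
rewrite path_gis_pcat // gis_pairM IH gis_pair_class pe ptgt_pcat //.
exact: tpair_mulE.
Qed.

Lemma pair_nfK p q : ptgt p = ptgt q -> gis_pair (pair_nf p q) = tpair p q.
Proof.
elim/fpath_indl: q => [v pv|e q eq IH]; first by have := path_gisK p; rewrite pv.
rewrite ptgt_pcat // => pq.
rewrite pair_nf_pcat // gis_pairM IH // gis_pair_class; exact: tpair_mulS.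
Qed.

Lemma pair_gisK : cancel pair_gis gis_pair.
Proof.
move=> t; have [->|[p [q [pq ->]]]] := tpairP t; first by rewrite gis_pair_class.
by rewrite pair_gisE // pair_nfK.
Qed.

End Proposition2.

Theorem proposition2 (G : digraph) (hG : no_sinks G) :
  exists Phi : {multiplicative (gis G) -> (path_pairs G)},
    [/\ forall v : vertex G, Phi (sv v) = tpair (vpath v) (vpath v),
        forall e : edge G, Phi (se e) = tpair (epath e) (vpath (tgt e)),
        forall e : edge G, Phi (ss e) = tpair (vpath (tgt e)) (epath e),
        Phi sz = tzero
      & bijective Phi].
Proof.
exists (@gis_pair G); split=> [v|e|e||] /=; rewrite ?gis_pair_class //.
exact: Bijective (@gis_pairK G) (@pair_gisK G).
Qed.
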